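(* For every integer $k\geq1$, $\delta>0$, $\epsilon>0$ and function $\sigma\colon\mathbb{N}\to(0,1)$ there is $N=N(k,\delta,\epsilon,\sigma)$ such that for all finite nonempty sets $V,W$ and every $(k,\delta)$-stable function $f\colon V\times W\to[0,1]$ there are partitions $V=V_0\cup V_1\cup\ldots\cup V_m$ and $W=W_0\cup W_1\cup\ldots\cup W_n$ with $m,n\leq N$ satisfying: (i) for all $(i,j)\in[m]\times[n]$, $(V_i,W_j)$ is $(5\delta+\epsilon;\sigma(mn))$-homogeneous; (ii) $|V_i|=|V_j|$ for all $1\leq i,j\leq m$ and $|W_i|=|W_j|$ for all $1\leq i,j\leq n$; (iii) $|V_0|\leq\epsilon|V|$ and $|W_0|\leq\epsilon|W|$.
   Context: $[n]=\{1,\ldots,n\}$. $f\colon V\times W\to\mathbb{R}$ is $(k,\delta)$-stable if there are no $a_1,\ldots,a_k\in V$, $b_1,\ldots,b_k\in W$ with $|f(a_i,b_j)-f(a_j,b_i)|\geq\delta$ for all $i<j$. With $\mu(X)=|X|/|V|$ and $\nu(Y)=|Y|/|W|$, a pair $(V_*,W_* )$ with $V_*\subseteq V$, $W_*\subseteq W$ is $(\delta;\gamma)$-homogeneous if there are $V'\subseteq V_*$ with $\mu(V')\geq(1-\gamma)\mu(V_* )$, $W'\subseteq W_*$ with $\nu(W')\geq(1-\gamma)\nu(W_* )$, some $r\in[0,1]$ with $\mu(\{a\in V_*:|f(a,b)-r|\leq\delta\})\geq(1-\gamma)\mu(V_* )$ for all $b\in W'$, and some $s\in[0,1]$ with $\nu(\{b\in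 W_*:|f(a,b)-s|\leq\delta\})\geq(1-\gamma)\nu(W_* )$ for all $a\in V'$. *)

(* Defs.v *)
From mathcomp Require Import all_boot all_order all_algebra.
From mathcomp Require Import reals.

Set Implicit Arguments.
Unset Strict Implicit.
Unset Printing Implicit Defensive.

Import Order.TTheory GRing.Theory Num.Theory.
Local Open Scope ring_scope.

Definition stable_fun (R : realType) (V W : finType) (k : nat) (delta : R)
    (f : V -> W -> R) : Prop :=
  ~ exists (a : 'I_k -> V) (b : 'I_k -> W),
      forall i j : 'I_k, (i < j)%N ->
        delta <= `|f (a i) (b j) - f (a j) (b i)|.

(* Normalized counting measure. *)
Definition density (R : realType) (T : finType) (X : {set T}) : R :=
  #|X|%:R / #|T|%:R.

Definition homogeneous_pair (R : realType) (V W : finType) (f : V -> W -> R)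
    (delta gamma : R) (Vs : {set V}) (Ws : {set W}) : Prop :=
  exists (V' : {set V}) (W' : {set W}),
    [/\ V' \subset Vs /\ (1 - gamma) * density R Vs <= density R V',
        W' \subset Ws /\ (1 - gamma) * density R Ws <= density R W',
        exists r : R, 0 <= r <= 1 /\
          forall b, b \in W' ->
            (1 - gamma) * density R Vs
              <= density R [set a in Vs | `|f a b - r| <= delta]
      & exists s : R, 0 <= s <= 1 /\
          forall a, a \in V' ->
            (1 - gamma) * density R Ws
              <= density R [set b in Ws | `|f a b - s| <= delta]].

(* P ord0 is the exceptional part, and is the only part allowed to be empty. *)
Definition exceptional_partition (T : finType) (m : nat)
    (P : 'I_m.+1 -> {set T}) : Prop :=
  [/\ \bigcup_(i < m.+1) P i = [set: T],
      forall i j, i != j -> [disjoint P i & P j]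
    & forall i, i != ord0 -> P i != set0].

(* Main.v *)
(* One side at a time, call a set X of rows undivided at scale g if no column b
   has both a 1/g-fraction of X with f(-, b) <= c delta and a 1/g-fraction with
   f(-, b) >= (c + 2) delta.  Stability bounds the height of binary trees of
   such splittings, so splitting X produces a part of smaller height.
   By induction on the height, V is partitioned up to a small remainder into
   pieces that are undivided at a scale depending arbitrarily on their number:
   parts of smaller height are peeled off X at successively finer scales until
   the mass of what is left stabilises, and are then partitioned by induction.
   On an undivided piece each f(-, b) is within 3/2 delta of a constant off a small
   set, and for undivided pieces of V and of W these constants agree up to
   3 delta, which gives 9/2 delta. Cutting the pieces into equal chunks only
   multiplies the proportion of exceptions by a bounded factor. *)
Require Import Defs.
From mathcomp Require Import all_boot all_order all_algebra.
From mathcomp Require Import reals.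
From mathcomp Require boolp.
From mathcomp Require Import zify ring lra.

Set Implicit Arguments.
Unset Strict Implicit.
Unset Printing Implicit Defensive.

Import Order.TTheory GRing.Theory Num.Theory.
Local Open Scope ring_scope.

(** * Binary trees of splittings and their bound under stability *)

(** Full binary trees of depth [d], as in Shelah's 2-rank or the Littlestone dimension: each branch
    picks its own labels in [S], and every leaf must be a nonempty subset of [A]. *)
Fixpoint has_tree (V Nd : finType) (L U : Nd -> {set V}) (d : nat)
    (S : {set Nd}) (A : {set V}) : bool :=
  if d is d'.+1 then
    [exists n in S, has_tree L U d' S (A :&: L n)
                    && has_tree L U d' S (A :&: U n)]
  else A != set0.

Lemma has_treeS (V Nd : finType) (L U : Nd -> {set V}) d
    (S S' : {set Nd}) (A A' : {set V}) :
  S \subset S' -> A \subset A' ->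
  has_tree L U d S A -> has_tree L U d S' A'.
Proof.
elim: d S S' A A' => [|d IH] S S' A A' sS sA /=.
  by apply: contraNneq => A0; rewrite -subset0 -A0.
case/exists_inP => n nS /andP[hL hU]; apply/exists_inP; exists n.
  exact: (subsetP sS).
by rewrite (IH S S' _ _ sS (setSI _ sA) hL) (IH S S' _ _ sS (setSI _ sA) hU).
Qed.

Lemma has_tree_neq0 (V Nd : finType) (L U : Nd -> {set V}) d
    (S : {set Nd}) (A : {set V}) :
  has_tree L U d S A -> A != set0.
Proof.
elim: d A => [|d IH] A //= /exists_inP[n _ /andP[/IH + _]].
by apply: contraNneq => ->; rewrite set0I.
Qed.

(** Ramsey argument for trees with two colours of nodes. If the root lies in [S1], either one of its
    two subtrees contains a tree of height [d2] in [S2], or both contain one of height [d1 - 1] in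
    [S1], and the root joins them. *)
Lemma has_tree_split (V Nd : finType) (L U : Nd -> {set V}) d1 d2
    (S S1 S2 : {set Nd}) (A : {set V}) :
  S \subset S1 :|: S2 -> has_tree L U (d1 + d2) S A ->
  has_tree L U d1 S1 A || has_tree L U d2 S2 A.
Proof.
move=> sS; have [d] := ubnP (d1 + d2)%N.
elim: d d1 d2 A => // d IH d1 d2 A ltd tA.
case: d1 ltd tA => [|d1] ltd tA; first by rewrite /= (has_tree_neq0 tA).
case: d2 ltd tA => [|d2] ltd tA.
  by rewrite /= (has_tree_neq0 tA) orbT.
move: (tA); rewrite addSn => /exists_inP[n nS /andP[tL tU]].
have /orP[n1|n2] : (n \in S1) || (n \in S2) by have := subsetP sS _ nS; rewrite inE.
- have sub B : has_tree L U d2.+1 S2 (A :&: B) -> has_tree L U d2.+1 S2 A.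
    exact/has_treeS/subsetIl.
  have /orP[hL|/sub->] := IH d1 d2.+1 _ ltac:(lia) tL; last by rewrite orbT.
  have /orP[hU|/sub->] := IH d1 d2.+1 _ ltac:(lia) tU; last by rewrite orbT.
  by apply/orP; left; apply/exists_inP; exists n => //; apply/andP.
- have sub B : has_tree L U d1.+1 S1 (A :&: B) -> has_tree L U d1.+1 S1 A.
    exact/has_treeS/subsetIl.
  rewrite -addSnnS in tL; rewrite -addSnnS in tU.
  have /orP[/sub->//|hL] := IH d1.+1 d2 _ ltac:(lia) tL.
  have /orP[/sub->//|hU] := IH d1.+1 d2 _ ltac:(lia) tU.
  by apply/orP; right; apply/exists_inP; exists n => //; apply/andP.
Qed.

(** One colour is split off at a time, at a cost of [h] levels each. The extra level settles the end
    of the induction, where no label is left for a root. *)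
Lemma has_tree_monochromatic (V Nd : finType) (L U : Nd -> {set V})
    (col : Nd -> nat) g h (A : {set V}) :
  has_tree L U (g * h).+1 [set n | (col n < g)%N] A ->
  exists c, has_tree L U h [set n | col n == c] A.
Proof.
elim: g A => [|g IH] A.
  by case/exists_inP => n; rewrite inE.
rewrite mulSn -addnS => tA.
have sub : [set n | (col n < g.+1)%N]
    \subset [set n | col n == g] :|: [set n | (col n < g)%N].
  by apply/subsetP => n; rewrite !inE ltnS leq_eqVlt.
by have /orP[|/IH//] := has_tree_split sub tA; exists g.
Qed.

(** A step of the ladder argument goes below the root and divides the remaining [2h + 1] levels as
    [(h + 1) + h]. *)
Definition ladder_height (k : nat) : nat := iter k (fun h => h.*2.+2) 0%N.

(* Hodges' argument: either some a0 in A has f(a0, -) <= x + delta on a large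
   subtree, and the pair (a0, root of that subtree) is followed by the part of
   A lying above x + 2 delta at that root, or the pair formed by the root of the
   whole tree and any a0 below x there is followed by nodes above x + delta. *)
Lemma has_tree_ladder (R : realType) (V W Nd : finType) (L U : Nd -> {set V})
    (f : V -> W -> R) (b : Nd -> W) (x delta : R) (k : nat)
    (S : {set Nd}) (A : {set V}) :
  (forall n a, n \in S -> a \in L n -> f a (b n) <= x) ->
  (forall n a, n \in S -> a \in U n -> x + 2 * delta <= f a (b n)) ->
  has_tree L U (ladder_height k) S A ->
  exists s : seq (V * Nd),
    [/\ size s = k, all (fun p => (p.1 \in A) && (p.2 \in S)) s
      & pairwise (fun p q =>
          delta <= `|f p.1 (b q.2) - f q.1 (b p.2)|) s].
Proof.
elim: k S A => [|k IH] S A hL hU; first by exists [::].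
rewrite /ladder_height iterS -/(ladder_height k); set h := ladder_height k => tA.
pose S1 a := [set n in S | f a (b n) <= x + delta].
pose S2 a := [set n in S | x + delta < f a (b n)].
have ext n0 a0 (A' : {set V}) (S' : {set Nd}) :
    n0 \in S -> a0 \in A -> A' \subset A -> S' \subset S ->
    (forall a n, a \in A' -> n \in S' ->
       delta <= `|f a0 (b n) - f a (b n0)|) ->
    has_tree L U h S' A' ->
  exists s : seq (V * Nd),
    [/\ size s = k.+1, all (fun p => (p.1 \in A) && (p.2 \in S)) s
      & pairwise (fun p q =>
          delta <= `|f p.1 (b q.2) - f q.1 (b p.2)|) s].
  move=> n0S a0A sA sS hd tA'.
  have [||s [szs /allP als pws]] := IH S' A' _ _ tA'.
  - by move=> n a /(subsetP sS); exact: hL.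
  - by move=> n a /(subsetP sS); exact: hU.
  exists ((a0, n0) :: s); split; rewrite /= ?szs ?a0A ?n0S //=.
    apply/allP => p /als /andP[pA pS].
    by rewrite (subsetP sA _ pA) (subsetP sS _ pS).
  by rewrite pws andbT; apply/allP => p /als /andP[pA pS]; exact: hd.
case: (boolP [exists a0 in A, has_tree L U h.+1 (S1 a0) A]).
- case/exists_inP => a0 a0A /= /exists_inP[n0 n0S1 /andP[_ tU]].
  have n0S : n0 \in S by move: n0S1; rewrite inE => /andP[].
  apply: (ext n0 a0 _ _ n0S a0A (subsetIl _ _) _ _ tU).
    by apply/subsetP => n; rewrite inE => /andP[].
  move=> a n /setIP[_ /(hU _ _ n0S) ua]; rewrite inE => /andP[_ la].
  rewrite ler_normr; apply/orP; right; lra.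
- move=> /exists_inPn noS1.
  have /exists_inP[n0 n0S /andP[tL _]] :
    [exists n in S, has_tree L U h.*2.+1 S (A :&: L n)
                    && has_tree L U h.*2.+1 S (A :&: U n)] := tA.
  have /set0Pn[a0 /setIP[a0A a0L]] := has_tree_neq0 tL.
  have tL' : has_tree L U (h.+1 + h) S (A :&: L n0) by rewrite addSn addnn.
  have sub : S \subset S1 a0 :|: S2 a0.
    by apply/subsetP => n nS; rewrite !inE nS /= leNgt orNb.
  have /orP[tS1|tS2] := has_tree_split sub tL'.
    by case/negP: (noS1 a0 a0A); apply: has_treeS tS1; rewrite ?subsetIl.
  apply: (ext n0 a0 _ _ n0S a0A (subsetIl _ _) _ _ tS2).
    by apply/subsetP => n; rewrite inE => /andP[].
  move=> a n /setIP[_ /(hL _ _ n0S) la]; rewrite inE => /andP[_ ua].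
  rewrite ler_normr; apply/orP; left; lra.
Qed.

Definition threshold_le (R : realType) (V W : finType) (delta : R) (G : nat)
    (f : V -> W -> R) (n : W * 'I_G) : {set V} :=
  [set a | f a n.1 <= n.2%:R * delta].

Definition threshold_ge (R : realType) (V W : finType) (delta : R) (G : nat)
    (f : V -> W -> R) (n : W * 'I_G) : {set V} :=
  [set a | (n.2.+2)%:R * delta <= f a n.1].

Definition stable_height (G k : nat) : nat := (G * ladder_height k).+1.

(** Colouring the nodes by their level yields a tree with a single level [c]; the ladder argument
    with [x = c * delta] then produces [k] pairs that contradict stability. *)
Lemma stable_no_tree (R : realType) (V W : finType) (delta : R) (G k : nat)
    (f : V -> W -> R) (A : {set V}) :
  stable_fun k delta f ->
  ~~ has_tree (threshold_le delta (G := G) f) (threshold_ge delta f)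
       (stable_height G k) [set: W * 'I_G] A.
Proof.
move=> stf; apply/negP => tA; apply: stf.
have [c tc] : exists c, has_tree (threshold_le delta (G := G) f)
    (threshold_ge delta f) (ladder_height k)
    [set n : W * 'I_G | nat_of_ord n.2 == c] A.
  apply: (@has_tree_monochromatic _ _ _ _ _ G); apply: has_treeS tA => //.
  by apply/subsetP => n _; rewrite inE ltn_ord.
have [n a|n a|s [szs _ /(pairwiseP) pws]] :=
  has_tree_ladder (f := f) (b := fst) (x := c%:R * delta) (delta := delta) _ _ tc.
- by rewrite !inE => /eqP <-.
- by rewrite !inE => /eqP <-; rewrite -addn2 natrD mulrDl.
(* For [k = 0] there is no pair to serve as a default of [nth], and the families indexed by ['I_0]
   come from ex falso. *)
case: k tA tc szs => [|k] _ tc szs.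
  by do 2![exists (fun i : 'I_0 => False_rect _ (notF (ltn_ord i)))] => -[].
case: s szs pws => // p0 s szs pws.
exists (fun i => (nth p0 (p0 :: s) i).1), (fun i => (nth p0 (p0 :: s) i).2.1).
by move=> i j ij; apply: pws; rewrite // inE szs ltn_ord.
Qed.

(** * Disjoint families of sets *)

Local Open Scope nat_scope.

Definition disjoint_seq (V : finType) (P : seq {set V}) : bool :=
  pairwise (fun X Y : {set V} => [disjoint X & Y]) P.

Lemma bigcup_seqP (V : finType) (P : seq {set V}) x :
  reflect (exists2 X, X \in P & x \in X) (x \in \bigcup_(X <- P) X).
Proof.
by rewrite bigcup_seq; apply: (iffP bigcupP) => -[X XP xX]; exists X.
Qed.

Lemma sub_bigcup_seq (V : finType) (P : seq {set V}) X :
  X \in P -> X \subset \bigcup_(Y <- P) Y.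
Proof. by move=> XP; apply/subsetP => x xX; apply/bigcup_seqP; exists X. Qed.

Lemma disjoint_seq_cons (V : finType) (X : {set V}) (P : seq {set V}) :
  disjoint_seq (X :: P) = [disjoint X & \bigcup_(Y <- P) Y] && disjoint_seq P.
Proof.
rewrite /disjoint_seq /=; congr (_ && _); apply/allP/idP => [h|h Y YP].
  rewrite -setI_eq0; apply/eqP/setP => x; rewrite !inE.
  apply/negP => /andP[xX /bigcup_seqP[Y YP xY]].
  by have /pred0P/(_ x) := h _ YP; rewrite /= xX xY.
by apply: disjointWr h; exact: sub_bigcup_seq.
Qed.

Lemma disjoint_seq_cat (V : finType) (P Q : seq {set V}) :
  disjoint_seq P -> disjoint_seq Q ->
  [disjoint \bigcup_(X <- P) X & \bigcup_(X <- Q) X] -> disjoint_seq (P ++ Q).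
Proof.
move=> dP dQ dPQ; rewrite /disjoint_seq pairwise_cat; apply/and3P; split=> //.
apply/allrelP => X Y XP YQ; apply: disjointWl (sub_bigcup_seq XP) _.
exact: disjointWr (sub_bigcup_seq YQ) _.
Qed.

Lemma card_bigcup_seq (V : finType) (P : seq {set V}) :
  disjoint_seq P -> #|\bigcup_(X <- P) X| = \sum_(X <- P) #|X|.
Proof.
elim: P => [|X P IH]; first by rewrite !big_nil cards0.
rewrite disjoint_seq_cons !big_cons => /andP[dX /IH <-].
by move: dX; rewrite -leq_card_setU => /eqP.
Qed.

Lemma leq_card_subU (V : finType) (E E1 E2 : {set V}) (c s t : nat) :
  E \subset E1 :|: E2 -> c * #|E1| <= s -> c * #|E2| <= t -> c * #|E| <= s + t.
Proof.
move=> sE c1 c2; apply: leq_trans (leq_add c1 c2); rewrite -mulnDr.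
by rewrite leq_mul2l (leq_trans (subset_leq_card sE)) ?orbT ?leq_card_setU.
Qed.

(** A monotone majorant of [g]: a scale chosen through it serves every size up to [n], before the
    actual size is known. *)
Definition upto (g : nat -> nat) (n : nat) : nat := \max_(x < n.+1) g x.

Lemma leq_upto g n x : x <= n -> g x <= upto g n.
Proof.
rewrite -ltnS => xn.
exact: (leq_bigmax (F := fun i : 'I_n.+1 => g i) (Ordinal xn)).
Qed.

(** * Partitions into undivided pieces, by induction on the tree height *)

Definition undivided (V Nd : finType) (L U : Nd -> {set V}) (g : nat)
    (X : {set V}) : bool :=
  [forall n, (g * #|X :&: L n| < #|X|) || (g * #|X :&: U n| < #|X|)].

Lemma undividedS (V Nd : finType) (L U : Nd -> {set V}) g g' (X : {set V}) :
  g <= g' -> undivided L U g' X -> undivided L U g X.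
Proof.
move=> gg' /forallP h; apply/forallP => n.
by case/orP: (h n) => hn; apply/orP; [left|right];
  apply: leq_ltn_trans hn; rewrite leq_mul2r gg' orbT.
Qed.

(** The scale is a function of the number of pieces because the tolerance [sigma] of the theorem
    depends on the number of parts. *)
Definition undivided_partition (V Nd : finType) (L U : Nd -> {set V})
    (c : nat) (g : nat -> nat) (N : nat) (A : {set V}) (P : seq {set V}) :=
  [/\ disjoint_seq P, \bigcup_(X <- P) X \subset A, size P <= N,
      c * #|A :\: \bigcup_(X <- P) X| <= #|A|
    & all (undivided L U (g (size P))) P].

Definition partition_property (d : nat) :=
  forall (c : nat) (g : nat -> nat), exists N, forall (V Nd : finType)
    (L U : Nd -> {set V}) (A : {set V}), ~~ has_tree L U d setT A ->
    exists P, undivided_partition L U c g N A P.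

(* The sets are partitioned one after the other, each one finely enough for any
   number of pieces that the following ones may still produce. *)
Lemma partition_property_seq d : partition_property d ->
  forall (t c : nat) (g : nat -> nat), exists N, forall (V Nd : finType)
    (L U : Nd -> {set V}) (Bs : seq {set V}), disjoint_seq Bs ->
    all (fun B => ~~ has_tree L U d setT B) Bs -> size Bs <= t ->
    exists P, undivided_partition L U c g N (\bigcup_(B <- Bs) B) P.
Proof.
move=> Hd; elim=> [|t IH] c g.
  exists 0 => V Nd L U [|//] _ _ _; exists [::]; split => //.
  by rewrite !big_nil set0D cards0 muln0.
have [N2 hN2] := boolp.choice (fun M1 => IH c (fun x => g (M1 + x))).
have [N1 hN1] := Hd c (fun M1 => upto (fun x => g (M1 + x)) (N2 M1)).
exists (N1 + upto N2 N1) => V Nd L U [|B Bs].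
  move=> _ _ _; exists [::]; split => //.
  by rewrite !big_nil set0D cards0 muln0.
rewrite disjoint_seq_cons => /andP[dB dBs] /= /andP[tB tBs] szs.
have [P1 [dP1 sP1 zP1 cP1 gP1]] := hN1 V Nd L U B tB.
have [P2 [dP2 sP2 zP2 cP2 gP2]] := hN2 (size P1) V Nd L U Bs dBs tBs szs.
exists (P1 ++ P2); split.
- apply: disjoint_seq_cat => //.
  exact: disjointWl sP1 (disjointWr sP2 dB).
- by rewrite big_cat big_cons; exact: setUSS.
- rewrite size_cat leq_add //; apply: leq_trans zP2 _; exact: leq_upto.
- rewrite big_cat big_cons /=.
  set X := \bigcup_(_ <- Bs) _ in dB cP2 sP2 *.
  set Y1 := \bigcup_(_ <- P1) _ in cP1 *; set Y2 := \bigcup_(_ <- P2) _ in cP2 *.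
  have sub : (B :|: X) :\: (Y1 :|: Y2) \subset (B :\: Y1) :|: (X :\: Y2).
    by apply/subsetP => x; rewrite !inE; do !case: (_ \in _).
  have /eqP -> : #|B :|: X| == #|B| + #|X| by rewrite (leq_card_setU B X).
  exact: leq_card_subU sub cP1 cP2.
- rewrite all_cat size_cat gP2 andbT; apply/allP => Z ZP1.
  apply: undividedS (allP gP1 _ ZP1).
  exact: (leq_upto (fun x => g (size P1 + x))).
Qed.

(** While [A] is divided at scale [alpha], some node has both of its sides of size at least
    [#|A| / alpha] in [A]. One side carries no tree of height [d], for otherwise the node would join
    two of them; that side is removed. Stopping once [e * #|A| < s] keeps every removed part large,
    which bounds their number. *)
Lemma peel (V Nd : finType) (L U : Nd -> {set V}) d (alpha e s : nat)
    (A : {set V}) :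
  0 < s -> ~~ has_tree L U d.+1 setT A ->
  exists (A' : {set V}) (Bs : seq {set V}),
    [/\ disjoint_seq (A' :: Bs), A = A' :|: \bigcup_(B <- Bs) B,
        all (fun B => ~~ has_tree L U d setT B) Bs,
        all (fun B : {set V} => s <= alpha * e * #|B|) Bs
      & undivided L U alpha A' \/ e * #|A'| < s].
Proof.
move=> s0; have [m] := ubnP #|A|; elim: m A => // m IH A ltm tA.
case: (boolP (undivided L U alpha A)) => [gA|].
  by exists A, [::]; split; rewrite ?big_nil ?setU0 //; left.
case: (ltnP (e * #|A|) s) => [eA _|eA].
  by exists A, [::]; split; rewrite ?big_nil ?setU0 //; right.
rewrite negb_forall => /existsP[n]; rewrite negb_or -!leqNgt => /andP[nL nU].
have [B [sB tB cB]] : exists B : {set V},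
    [/\ B \subset A, ~~ has_tree L U d setT B & #|A| <= alpha * #|B|].
  have := tA; rewrite /= negb_exists => /forallP/(_ n).
  by rewrite inE /= negb_and => /orP[tB|tB];
    [exists (A :&: L n)|exists (A :&: U n)]; rewrite subsetIl.
have sB0 : s <= alpha * e * #|B| by nia.
have B0 : 0 < #|B| by nia.
have cAB : #|A :\: B| = #|A| - #|B| by rewrite cardsD (setIidPr sB).
have tAB : ~~ has_tree L U d.+1 setT (A :\: B).
  by apply: contra tA; apply: has_treeS; rewrite ?subsetDl.
have [|A' [Bs [dA eAB tBs cBs hA']]] := IH (A :\: B) _ tAB.
  by rewrite cAB; have := subset_leq_card sB; lia.
have /andP[dA' dBs] : [disjoint A' & \bigcup_(Y <- Bs) Y] && disjoint_seq Bs.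
  by rewrite -disjoint_seq_cons.
have dB : [disjoint B & A' :|: \bigcup_(Y <- Bs) Y].
  by rewrite -eAB -setI_eq0 setIDA [B :&: A]setIC -setIDA setDv setI0.
have [dBA' dBBs] : [disjoint B & A'] /\ [disjoint B & \bigcup_(Y <- Bs) Y].
  by split; apply: disjointWr dB; rewrite ?subsetUl ?subsetUr.
exists A', (B :: Bs); split.
- rewrite !disjoint_seq_cons big_cons dBBs dBs !andbT -setI_eq0 setIUr setU_eq0.
  by rewrite !setI_eq0 disjoint_sym dBA'.
- by rewrite big_cons setUCA -eAB -{1}(setID A B) (setIidPr sB).
- by rewrite /= tB.
- by rewrite /= sB0.
- by [].
Qed.

(* The mass of the remainder A decreases by a fraction 1/(3c) of the total at
   each failed attempt, so that at most 3c scales alpha are ever tried. *)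
Lemma peel_partition d : partition_property d ->
  forall (u t c : nat) (g : nat -> nat), exists N, forall (V Nd : finType)
    (L U : Nd -> {set V}) (A : {set V}) (Bs : seq {set V}),
    disjoint_seq (A :: Bs) -> all (fun B => ~~ has_tree L U d setT B) Bs ->
    ~~ has_tree L U d.+1 setT A -> size Bs <= t ->
    3 * c * #|A| <= u * #|A :|: \bigcup_(B <- Bs) B| ->
    exists P, undivided_partition L U c g N (A :|: \bigcup_(B <- Bs) B) P.
Proof.
move=> Hd; elim=> [|u IH] t c g.
  have [N hN] := partition_property_seq Hd t (3 * c) g.
  exists N => V Nd L U A Bs; rewrite disjoint_seq_cons => /andP[dA dBs] tBs _.
  move=> szs cA; have [P [dP sP zP cP gP]] := hN _ _ _ _ _ dBs tBs szs.
  exists P; split=> //; first exact: subset_trans sP (subsetUr _ _).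
  set X := \bigcup_(_ <- Bs) _ in dA cA cP sP *.
  set Y := \bigcup_(_ <- P) _ in sP cP *.
  (* With [u = 0] the hypothesis gives [c * #|A| = 0], so [A] may be left out entirely. *)
  have cAY : c * #|A :\: Y| <= 0.
    apply: leq_trans (_ : c * #|A| <= 0); last by lia.
    by rewrite leq_mul2l subset_leq_card ?orbT ?subsetDl.
  have cXY : c * #|X :\: Y| <= #|X| by lia.
  rewrite setDUl (leq_trans (leq_card_subU (subxx _) cAY cXY)) //.
  by rewrite add0n subset_leq_card // subsetUr.
(* The sets in [Bs] are partitioned for both outcomes: their pieces used alone, or with [A'] as one
   more piece. *)
have [N1 hN1] := partition_property_seq Hd t (3 * c)
  (fun x => maxn (g x) (g x.+1)).
(* [A'] may have to stand among up to [N1.+1] pieces. *)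
pose alpha := upto g N1.+1.
(* A peeled part has at least [1 / (3 * c * alpha)] of the total mass, so at most [alpha * (3 * c)]
   of them arise. *)
have [N2 hN2] := IH (t + alpha * (3 * c)) c g.
exists (maxn N1.+1 N2) => V Nd L U A Bs dABs tBs tA szs cA.
have /andP[dA dBs] : [disjoint A & \bigcup_(Y <- Bs) Y] && disjoint_seq Bs.
  by rewrite -disjoint_seq_cons.
set X := \bigcup_(_ <- Bs) _ in dA cA *.
have [s0|s_gt0] := posnP #|A :|: X|.
  exists [::]; split; rewrite ?big_nil ?sub0set ?setD0 ?s0 ?muln0 //.
have [A' [Bs' [dA'Bs' eA tBs' cBs' hA']]] :=
  @peel _ _ L U d alpha (3 * c) _ A s_gt0 tA.
have /andP[dA' dBs'] :
    [disjoint A' & \bigcup_(Y <- Bs') Y] && disjoint_seq Bs'.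
  by rewrite -disjoint_seq_cons.
set X' := \bigcup_(_ <- Bs') _ in dA' eA *.
have cA' : #|A| = #|A'| + #|X'|.
  by apply/eqP; rewrite eA (leq_card_setU A' X').
have cS : #|A :|: X| = #|A| + #|X|.
  by apply/eqP; rewrite (leq_card_setU A X).
(* If the peeled parts exceed [1 / (3 * c)] of the mass, they join [Bs] and [A'] satisfies the bound
   for [u]. Otherwise they go to the remainder and only the earlier [Bs] are partitioned. *)
case: (leqP (3 * c * #|X'|) #|A :|: X|) => cX'; last first.
  have eS : A :|: X = A' :|: \bigcup_(B <- Bs' ++ Bs) B.
    by rewrite big_cat /= -/X -/X' setUA -eA.
  rewrite eS; have [|||||P [dP sP zP cP gP]] := hN2 V Nd L U A' (Bs' ++ Bs).
  - rewrite disjoint_seq_cons big_cat /= -/X -/X'; apply/andP; split.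
      rewrite -setI_eq0 setIUr setU_eq0 !setI_eq0 dA' /=.
      by apply: disjointWl dA; rewrite eA subsetUl.
    by apply: disjoint_seq_cat => //; apply: disjointWl dA; rewrite eA subsetUr.
  - by rewrite all_cat tBs' tBs.
  - by apply: contra tA; apply: has_treeS; rewrite // eA subsetUl.
  - rewrite size_cat addnC leq_add // -(leq_pmul2r s_gt0).
    apply: leq_trans (_ : alpha * (3 * c) * #|X'| <= _); last first.
      by rewrite leq_mul2l subset_leq_card ?orbT // eA -setUA subsetU // subsetUl orbT.
     rewrite card_bigcup_seq // big_distrr /= -sum1_size big_distrl /=.
    rewrite big_seq [leqRHS]big_seq; apply: leq_sum => B BBs'.
    by rewrite mul1n; exact: (allP cBs').
  - rewrite -eS -(leq_add2r (3 * c * #|X'|)) -mulnDr -cA' (leq_trans cA) //.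
    by rewrite mulSn addnC leq_add2l ltnW.
  by exists P; split=> //; apply: leq_trans zP (leq_maxr _ _).
have [P [dP sP zP cP gP]] := hN1 V Nd L U Bs dBs tBs szs.
rewrite -/X in sP cP; set Y := \bigcup_(_ <- P) _ in sP cP.
(* If [A'] is small, all of [A] goes to the remainder: [A'], the peeled parts and the loss inside
   [X] each account for at most [1 / (3 * c)] of the mass. *)
case: hA' => [gA'|cA'0]; last first.
  exists P; split=> //; first exact: subset_trans sP (subsetUr _ _).
  - by rewrite leq_max (leqW zP).
  - have cA'X' : 3 * c * #|A| <= #|A :|: X| + #|A :|: X|.
      by rewrite cA' mulnDr leq_add // ltnW.
    have cAXY : 3 * c * #|(A :|: X) :\: Y| <= #|A :|: X| + #|A :|: X| + #|X|.
      by apply: leq_card_subU cA'X' cP; rewrite setDUl setSU ?subsetDl.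
    rewrite -(leq_pmul2l (isT : 0 < 3)) mulnA (leq_trans cAXY) //.
    by rewrite !mulSn mul0n addn0 addnA leq_add2l subset_leq_card ?subsetUr.
  - by apply/allP => Z /(allP gP); apply: undividedS; rewrite leq_maxl.
exists (A' :: P); split.
- rewrite disjoint_seq_cons dP andbT; apply: disjointWr sP _.
  by apply: disjointWl dA; rewrite eA subsetUl.
- by rewrite big_cons; apply: setUSS => //; rewrite eA subsetUl.
- by rewrite leq_max /= ltnS zP.
- rewrite big_cons -/Y.
  have sub : (A :|: X) :\: (A' :|: Y) \subset X' :|: (X :\: Y).
    rewrite eA; apply/subsetP => x; rewrite !inE.
    by case: (x \in A'); case: (x \in X'); case: (x \in Y).
  have cXY : 3 * c * #|(A :|: X) :\: (A' :|: Y)| <= #|A :|: X| + #|X|.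
    exact: leq_card_subU sub cX' cP.
  rewrite -(leq_pmul2l (isT : 0 < 3)) mulnA (leq_trans cXY) //.
  rewrite !mulSn mul0n addn0 leq_add2l.
  by rewrite (leq_trans (subset_leq_card (subsetUr A X))) ?leq_addr.
- apply/andP; split; first by apply: undividedS gA'; apply: leq_upto.
  by apply/allP => Z /(allP gP); apply: undividedS; rewrite leq_maxr.
Qed.

Lemma partition_propertyP d : partition_property d.
Proof.
elim: d => [|d IH] c g.
  exists 0 => V Nd L U A /negPn/eqP ->; exists [::]; split => //.
    by rewrite big_nil.
  by rewrite set0D cards0 muln0.
(* At the start nothing has been peeled, and [u = 3 * c] makes the bound on the mass of [A]
   trivial. *)
have [N hN] := peel_partition IH (3 * c) 0 c g.
exists N => V Nd L U A tA.
have := hN V Nd L U A [::]; rewrite big_nil setU0; apply=> //.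
Qed.

(** * Refinement into parts of equal size *)

Lemma exists_subset_card (V : finType) (X : {set V}) c :
  c <= #|X| -> exists2 Y : {set V}, Y \subset X & #|Y| = c.
Proof.
move=> cX; exists [set x in take c (enum X)].
  by apply/subsetP => x; rewrite inE => /mem_take; rewrite mem_enum.
rewrite cardsE (card_uniqP _) ?take_uniq ?enum_uniq //.
by rewrite size_take_min -cardE (minn_idPl cX).
Qed.

Lemma equal_chunks (V : finType) c (X : {set V}) : 0 < c ->
  exists Q : seq {set V},
    [/\ disjoint_seq Q, \bigcup_(Y <- Q) Y \subset X,
        all (fun Y : {set V} => #|Y| == c) Q & #|X :\: \bigcup_(Y <- Q) Y| < c].
Proof.
move=> c0; have [m] := ubnP #|X|; elim: m X => // m IH X ltm.
case: (ltnP #|X| c) => [Xc|cX].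
  by exists [::]; rewrite big_nil sub0set setD0.
have [Y sY cY] := exists_subset_card cX.
have cXY : #|X :\: Y| = #|X| - c by rewrite cardsD (setIidPr sY) cY.
have [|Q [dQ sQ eQ cQ]] := IH (X :\: Y); first by lia.
exists (Y :: Q); split.
- rewrite disjoint_seq_cons dQ andbT; apply: disjointWr sQ _.
  by rewrite -setI_eq0 setIDA [Y :&: X]setIC -setIDA setDv setI0.
- by rewrite big_cons subUset sY (subset_trans sQ) ?subsetDl.
- by rewrite /= cY eqxx eQ.
- by rewrite big_cons -setDDl.
Qed.

(** The loss per piece is bounded by [c.-1] rather than [c], so that chunks of size 1 leave nothing
    over. *)
Lemma equal_chunks_seq (V : finType) c (P : seq {set V}) :
  0 < c -> disjoint_seq P ->
  exists Q : seq {set V},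
    [/\ disjoint_seq Q, \bigcup_(Y <- Q) Y \subset \bigcup_(X <- P) X,
        all (fun Y : {set V} => #|Y| == c) Q,
        all (fun Y : {set V} => has (fun X : {set V} => Y \subset X) P) Q
      & #|\bigcup_(X <- P) X :\: \bigcup_(Y <- Q) Y| <= size P * c.-1].
Proof.
move=> c0; elim: P => [|X P IH].
  by move=> _; exists [::]; split => //; rewrite !big_nil set0D cards0.
rewrite disjoint_seq_cons => /andP[dX /IH[Q [dQ sQ eQ hQ cQ]]].
have [Q' [dQ' sQ' eQ' cQ']] := equal_chunks X c0.
exists (Q' ++ Q); rewrite big_cat big_cons /=.
set A := \bigcup_(_ <- P) _ in dX sQ cQ *.
set B := \bigcup_(_ <- Q) _ in sQ cQ *; set B' := \bigcup_(_ <- Q') _ in sQ' cQ' *.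
split.
- by apply: disjoint_seq_cat => //; apply: disjointWl sQ' (disjointWr sQ dX).
- exact: setUSS.
- by rewrite all_cat eQ' eQ.
- rewrite all_cat; apply/andP; split; apply/allP => Y YQ /=.
    by rewrite (subset_trans (sub_bigcup_seq YQ) sQ').
  by rewrite (allP hQ _ YQ) orbT.
- have sub : (X :|: A) :\: (B' :|: B) \subset (X :\: B') :|: (A :\: B).
    by apply/subsetP => x; rewrite !inE; do !case: (_ \in _).
  rewrite -/B -/A /= mulSn.
  apply: leq_trans (subset_leq_card sub) _.
  apply: leq_trans (leq_of_leqif (leq_card_setU _ _)) (leq_add _ cQ).
  by rewrite -ltnS prednK.
Qed.

(* If the pieces of size |V| / (e |P|) would be empty, singletons are used and
   nothing is left over. *)
Lemma equal_refinement (V : finType) e (P : seq {set V}) :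
  2 < e -> 0 < #|V| -> disjoint_seq P ->
  e * #|~: \bigcup_(X <- P) X| <= #|V| ->
  exists c (Q : seq {set V}),
    [/\ disjoint_seq Q /\ 0 < c,
        all (fun Y : {set V} => #|Y| == c) Q,
        all (fun Y : {set V} => has (fun X : {set V} => Y \subset X) P) Q,
        #|V| <= 2 * e * size P * c /\ 0 < size Q <= 2 * e * size P
      & e * #|~: \bigcup_(Y <- Q) Y| <= 2 * #|V|].
Proof.
move=> e2 V0 dP cP; set M := size P.
have M0 : 0 < M.
  move: cP; rewrite /M; case: (P) => //=.
  by rewrite big_nil setC0 cardsT leqNgt ltn_Pmull // ltnW.
have eM0 : 0 < e * M by rewrite muln_gt0 M0 (ltnW (ltnW e2)).
pose q := #|V| %/ (e * M); pose c := maxn 1 q.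
have c0 : 0 < c by rewrite leq_max.
have [Q [dQ sQ eQ hQ cQ]] := equal_chunks_seq c0 dP.
have Vc : #|V| <= 2 * e * M * c.
  have -> : 2 * e * M * c = (c + c) * (e * M) by ring.
  (* Here [#|V| < (q + 1) * (e * M)], and [q + 1 <= 2 * c] since [c] is at least both [1] and
     [q]. *)
  apply: leq_trans (ltnW (ltn_ceil #|V| eM0)) _.
  by rewrite leq_mul2r -addn1 addnC leq_add ?orbT // leq_maxr.
(* Rounding costs [c - 1 <= q] points in each of [M] pieces, at most [#|V| / e] in all; what [P]
   leaves uncovered may cost as much again, whence the factor 2 below. *)
have left_over : e * (M * c.-1) <= #|V|.
  apply: leq_trans (leq_trunc_div #|V| (e * M)); rewrite -/q mulnA mulnC.
  rewrite leq_mul2r; apply/orP; right.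
  by rewrite /c; case: (leqP 1 q) => // _; exact: leq_pred.
have cQV : e * #|~: \bigcup_(Y <- Q) Y| <= 2 * #|V|.
  rewrite mul2n -addnn; set B := \bigcup_(_ <- Q) _ in sQ cQ *.
  set A := \bigcup_(_ <- P) _ in sQ cQ cP *.
  apply: leq_card_subU (_ : ~: B \subset ~: A :|: (A :\: B)) cP _.
    by apply/subsetP => x; rewrite !inE; case: (x \in A); case: (x \in B).
  by apply: leq_trans left_over; rewrite leq_mul2l cQ orbT.
exists c, Q; split => //; split => //.
have szQ : size Q * c = #|\bigcup_(Y <- Q) Y|.
  rewrite card_bigcup_seq // -sum1_size big_distrl /=.
  rewrite big_seq [RHS]big_seq; apply: eq_bigr => Y /(allP eQ)/eqP ->.
  exact: mul1n.
apply/andP; split.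
  (* An empty [Q] would give [e * #|V| <= 2 * #|V|], against [e > 2]. *)
  move: cQV; case: (Q) => //=.
  by rewrite big_nil setC0 cardsT leq_pmul2r // leqNgt e2.
by rewrite -(leq_pmul2r c0) szQ (leq_trans (max_card _)).
Qed.

Lemma exceptional_partition_seq (V : finType) (Q : seq {set V}) :
  disjoint_seq Q -> all (fun Y => Y != set0) Q ->
  exceptional_partition
    (fun i : 'I_(size Q).+1 => nth set0 ((~: \bigcup_(Y <- Q) Y) :: Q) i).
Proof.
move=> dQ nQ; split.
- apply/setP => x; rewrite inE; apply/bigcupP.
  have [/bigcup_seqP[Y YQ xY]|xQ] := boolP (x \in \bigcup_(Y <- Q) Y).
    have lt : (index Y Q).+1 < (size Q).+1 by rewrite ltnS index_mem.
    by exists (Ordinal lt); rewrite //= nth_index.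
  by exists ord0; rewrite // inE xQ.
- have dQ' : disjoint_seq ((~: \bigcup_(Y <- Q) Y) :: Q).
    by rewrite disjoint_seq_cons dQ andbT disjoints_subset.
  have dij (i j : 'I_(size Q).+1) : i < j ->
      [disjoint nth set0 ((~: \bigcup_(Y <- Q) Y) :: Q) i
       & nth set0 ((~: \bigcup_(Y <- Q) Y) :: Q) j].
    by apply: (pairwiseP set0 dQ'); rewrite inE ltn_ord.
  move=> i j; rewrite -val_eqE neq_ltn => /orP[/dij//|/dij].
  by rewrite disjoint_sym.
- by case=> -[|i] //= lti _; apply/(allP nQ)/mem_nth.
Qed.

(** * Concentration of columns and homogeneity of pairs *)

Lemma double_count (V W : finType) (X : {set V}) (Y : {set W})
    (p : V -> W -> bool) :
  \sum_(a in X) #|[set b in Y | p a b]| = \sum_(b in Y) #|[set a in X | p a b]|.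
Proof.
under eq_bigr do rewrite -sum1dep_card.
under [RHS]eq_bigr do rewrite -sum1dep_card.
rewrite (exchange_big_dep (fun b => b \in Y)) /=; last by move=> a b _ /andP[].
by apply: eq_bigr => b ->; apply: eq_bigl => a.
Qed.

Local Open Scope ring_scope.

Definition concentrated (R : realType) (V W : finType) (f : V -> W -> R)
    (rho : R) (g : nat) (X : {set V}) : Prop :=
  forall b, exists r : R,
    (g * #|[set a in X | (rho < `|f a b - r|)%R]| <= #|X|)%N.

(** Let [c] be the least level with [f a b <= c * delta] on a [1 / (2 * g)] fraction of [X]. Values
    below [(c - 1) * delta] are rare by minimality, values above [(c + 2) * delta] because [X] is
    undivided; the centre of this interval is the constant. *)
Lemma undivided_concentrated (R : realType) (V W : finType) (f : V -> W -> R)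
    (delta : R) (G g : nat) (X : {set V}) :
  0 < delta -> 1 <= G%:R * delta -> (0 < g)%N ->
  (forall a b, 0 <= f a b <= 1) ->
  undivided (threshold_le delta (G := G.+1) f) (threshold_ge delta f) (2 * g) X ->
  concentrated f (3 / 2 * delta) g X.
Proof.
move=> d0 dG g0 f01 /forallP hX b.
pose le c := X :&: [set a | f a b <= c%:R * delta].
pose ge c := X :&: [set a | c.+2%:R * delta <= f a b].
have {}hX c : (c <= G)%N -> ((2 * g * #|le c| < #|X|) || (2 * g * #|ge c| < #|X|))%N.
  by move=> cG; have := hX (b, inord c); rewrite /threshold_le /threshold_ge /= inordK.
have exc : exists c, (#|X| <= 2 * g * #|le c|)%N.
  exists G; have -> : le G = X.
    apply/setIidPl/subsetP => a _; rewrite inE.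
    by apply: le_trans dG; case/andP: (f01 a b).
  by nia.
case: (ex_minnP exc) => c cP cmin.
have cG : (c <= G)%N.
  apply: cmin; have -> : le G = X; last by nia.
  apply/setIidPl/subsetP => a _; rewrite inE.
  by apply: le_trans dG; case/andP: (f01 a b).
have gec : (2 * g * #|ge c| < #|X|)%N.
  by case/orP: (hX c cG) => //; rewrite ltnNge cP.
exists ((c%:R + 1 / 2) * delta).
set B := [set a in X | _].
have [B1 [sB cB1]] : exists B1 : {set V},
    B \subset B1 :|: ge c /\ (2 * g * #|B1| <= #|X|)%N.
  case: c cP cmin cG gec @B => [|c] cP cmin cG gec B.
    (* At level 0 there is no lower level to compare with, and [0 <= f] excludes values too far
       below the centre. *)
    exists set0; split; last by rewrite cards0 muln0.
    apply/subsetP => a; rewrite !inE => /andP[-> /=].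
    have /andP[fa0 _] := f01 a b.
    by rewrite ltr_normr => /orP[] h; lra.
  exists (le c); split; last first.
    by rewrite leqNgt; apply/negP => /ltnW/cmin; rewrite ltnn.
  apply/subsetP => a; rewrite !inE => /andP[-> /=].
  rewrite -(addn1 c) -(addn2 (c + 1)) !natrD.
  by rewrite ltr_normr => /orP[] h; apply/orP; [right|left]; lra.
have := leq_trans (subset_leq_card sB) (leq_card_setU _ _); nia.
Qed.

(** Projection onto [[0, 1]], where homogeneity wants its constant to lie. *)
Lemma clamp01 (R : realType) (r : R) :
  exists2 r' : R, 0 <= r' <= 1 &
    forall x, 0 <= x <= 1 -> `|x - r'| <= `|x - r|.
Proof.
have [r0|r0] := ltP r 0.
  exists 0 => [|x /andP[x0 x1]]; first lra.
  by rewrite !ger0_norm; lra.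
have [r1|r1] := ltP 1 r; last by exists r => //; rewrite r0 r1.
exists 1 => [|x /andP[x0 x1]]; first lra.
by rewrite !ler0_norm; lra.
Qed.

(** Double counting: otherwise every row of [X] would have more than [#|Y| / g] bad entries, while a
    column has at most [#|X| / g]. *)
Lemma average_small (V W : finType) (X : {set V}) (Y : {set W})
    (p : V -> W -> bool) (g : nat) :
  X != set0 ->
  (forall b, (g * #|[set a in X | p a b]| <= #|X|)%N) ->
  exists2 a, a \in X & (g * #|[set b in Y | p a b]| <= #|Y|)%N.
Proof.
move=> X0 hp; apply/exists_inP; apply: contraT => /exists_inPn hn.
have : (\sum_(a in X) g * #|[set b in Y | p a b]| <= #|X| * #|Y|)%N.
  rewrite -big_distrr /= double_count big_distrr /= mulnC -sum_nat_const.
  by apply: leq_sum.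
have : (#|X| * #|Y|.+1 <= \sum_(a in X) g * #|[set b in Y | p a b]|)%N.
  by rewrite -sum_nat_const; apply: leq_sum => a /hn; rewrite -ltnNge.
have : (0 < #|X|)%N by rewrite card_gt0.
nia.
Qed.

(** A typical row [a0] links the columns: for most [b], the value [f a0 b] is within [rho] of the
    constant of column [b] and within [rho] of the constant [s] of row [a0]. A third [rho] leads
    from the constant of column [b] to [f a b] for most [a]. *)
Lemma concentrated_pair (R : realType) (V W : finType) (f : V -> W -> R)
    (rho : R) (g : nat) (X : {set V}) (Y : {set W}) :
  (forall a b, 0 <= f a b <= 1) -> X != set0 ->
  concentrated f rho g X -> concentrated (fun b a => f a b) rho g Y ->
  exists r : R, 0 <= r <= 1 /\ exists Y' : {set W},
    [/\ Y' \subset Y, (g * #|Y :\: Y'| <= 2 * #|Y|)%N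
      & forall b, b \in Y' ->
          (g * #|[set a in X | (3 * rho < `|f a b - r|)%R]| <= #|X|)%N].
Proof.
move=> f01 X0 /boolp.choice[rX hX] hY.
have [a0 a0X ha0] := average_small Y X0 hX.
have [s hs] := hY a0.
have [r r01 hr] := clamp01 s; exists r; split => //.
pose B1 := [set b in Y | rho < `|f a0 b - rX b|].
pose B2 := [set b in Y | rho < `|f a0 b - s|].
exists (Y :\: (B1 :|: B2)); split; first exact: subsetDl.
  have sub : Y :\: (Y :\: (B1 :|: B2)) \subset B1 :|: B2.
    by apply/subsetP => b; rewrite !inE; do !case: (_ < _); case: (_ \in _).
  have := leq_trans (subset_leq_card sub) (leq_card_setU _ _).
  rewrite -/B1 in ha0; rewrite -/B2 in hs; nia.
move=> b; rewrite !inE => /andP[+ bY]; rewrite bY /= negb_or -!leNgt => /andP[h1 h2].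
apply: leq_trans (hX b); rewrite leq_mul2l; apply/orP; right.
apply: subset_leq_card; apply/subsetP => a; rewrite !inE => /andP[-> /= h].
rewrite ltNge; apply/negP => h3; move: h; apply/negP; rewrite -leNgt.
apply: le_trans (hr _ (f01 a b)) _.
have -> : f a b - s = (f a b - rX b) - (f a0 b - rX b) + (f a0 b - s) by ring.
apply: le_trans (ler_normD _ _) _.
have := ler_normB (f a b - rX b) (f a0 b - rX b).
lra.
Qed.

Lemma density_ge (R : realType) (V : finType) (gamma : R) (A S : {set V}) :
  S \subset A -> #|A :\: S|%:R <= gamma * #|A|%:R ->
  (1 - gamma) * density R A <= density R S.
Proof.
move=> sS cS; rewrite /density mulrA ler_wpM2r ?invr_ge0 //.
have : #|A|%:R = #|A :\: S|%:R + #|S|%:R :> R.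
  by rewrite -natrD addnC -{1}(setIidPr sS) cardsID.
lra.
Qed.

(** An exceptional set has at most [2 * #|X| / g <= 2 * K * #|X1| / g] points, hence at most
    [gamma * #|X1|]. The pair lemma is used twice with the roles of the sides exchanged, once for
    [r] and once for [s]. *)
Lemma homogeneous_subpair (R : realType) (V W : finType) (f : V -> W -> R)
    (rho D gamma : R) (g K : nat) (X X1 : {set V}) (Y Y1 : {set W}) :
  (forall a b, 0 <= f a b <= 1) -> 3 * rho <= D ->
  concentrated f rho g X -> concentrated (fun b a => f a b) rho g Y ->
  X1 \subset X -> Y1 \subset Y -> X1 != set0 -> Y1 != set0 ->
  (#|V| <= K * #|X1|)%N -> (#|W| <= K * #|Y1|)%N ->
  (0 < g)%N -> (2 * K)%:R <= g%:R * gamma ->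
  homogeneous_pair f D gamma X1 Y1.
Proof.
move=> f01 hD cX cY sX sY X0 Y0 KX KY g0 hg.
have sub0 (T : finType) (Z1 Z : {set T}) : Z1 \subset Z -> Z1 != set0 -> Z != set0.
  by move=> s; apply: contraNneq => Z0; rewrite -subset0 -Z0.
have [r [r01 [Y' [sY' cY' hY']]]] := concentrated_pair f01 (sub0 _ _ _ sX X0) cX cY.
have [s [s01 [X' [sX' cX' hX']]]] :=
  concentrated_pair (fun b a => f01 a b) (sub0 _ _ _ sY Y0) cY cX.
have small (T : finType) (Z1 Z B : {set T}) :
    (#|T| <= K * #|Z1|)%N -> (g * #|B| <= 2 * #|Z|)%N ->
    #|B|%:R <= gamma * #|Z1|%:R.
  move=> KZ gB.
  have gB' : (g * #|B| <= 2 * K * #|Z1|)%N.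
    apply: leq_trans gB _; rewrite -mulnA leq_mul2l /=.
    exact: leq_trans (max_card _) KZ.
  rewrite -(ler_pM2l (_ : 0 < g%:R)) ?ltr0n // mulrA -natrM.
  apply: le_trans (_ : (2 * K * #|Z1|)%:R <= _); first by rewrite ler_nat.
  by rewrite natrM ler_wpM2r.
exists (X1 :&: X'), (Y1 :&: Y'); split.
- split; first exact: subsetIl.
  apply: density_ge (subsetIl _ _) _; apply: le_trans (small _ _ _ _ KX cX').
  by rewrite ler_nat setDIr setDv set0U; apply/subset_leq_card/setSD.
- split; first exact: subsetIl.
  apply: density_ge (subsetIl _ _) _; apply: le_trans (small _ _ _ _ KY cY').
  by rewrite ler_nat setDIr setDv set0U; apply/subset_leq_card/setSD.
- exists r; split => // b /setIP[_ /hY' hb].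
  apply: density_ge; first by apply/subsetP => a; rewrite inE => /andP[].
  apply: le_trans (small _ _ X _ KX (leq_trans hb _)); last by rewrite leq_pmull.
  rewrite ler_nat; apply/subset_leq_card/subsetP => a; rewrite !inE => /andP[+ aX1].
  by rewrite aX1 (subsetP sX) //= -ltNge; exact: le_lt_trans.
- exists s; split => // a /setIP[_ /hX' ha].
  apply: density_ge; first by apply/subsetP => b; rewrite inE => /andP[].
  apply: le_trans (small _ _ Y _ KY (leq_trans ha _)); last by rewrite leq_pmull.
  rewrite ler_nat; apply/subset_leq_card/subsetP => b; rewrite !inE => /andP[+ bY1].
  by rewrite bY1 (subsetP sY) //= -ltNge; exact: le_lt_trans.
Qed.

Lemma stable_fun_swap (R : realType) (V W : finType) (k : nat) (delta : R)
    (f : V -> W -> R) :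
  stable_fun k delta f -> stable_fun k delta (fun b a => f a b).
Proof.
move=> stf [b [a h]]; apply: stf; exists a, b => i j ij.
by rewrite distrC; exact: h.
Qed.

(** * Choice of the constants and assembly *)

Theorem theorem6p1 (R : realType) (k : nat) (hk : (1 <= k)%N)
    (delta : R) (hdelta : 0 < delta) (eps : R) (heps : 0 < eps)
    (sigma : nat -> R) (hsigma : forall n, 0 < sigma n < 1) :
  exists N : nat, forall (V W : finType),
    (0 < #|V|)%N -> (0 < #|W|)%N ->
    forall f : V -> W -> R,
      (forall a b, 0 <= f a b <= 1) ->
      stable_fun k delta f ->
      exists (m n : nat) (P : 'I_m.+1 -> {set V}) (Q : 'I_n.+1 -> {set W}),
        [/\ (1 <= m <= N)%N /\ (1 <= n <= N)%N,
            exceptional_partition P /\ exceptional_partition Q,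
            forall (i : 'I_m.+1) (j : 'I_n.+1), i != ord0 -> j != ord0 ->
              homogeneous_pair f (5 * delta + eps) (sigma (m * n)%N) (P i) (Q j),
            (forall i j : 'I_m.+1, i != ord0 -> j != ord0 ->
               #|P i| = #|P j|) /\
            (forall i j : 'I_n.+1, i != ord0 -> j != ord0 ->
               #|Q i| = #|Q j|)
          & #|P ord0|%:R <= eps * #|V|%:R /\ #|Q ord0|%:R <= eps * #|W|%:R].
Proof.
(* The refinement needs [e > 2] and leaves a fraction [2 / e] uncovered. *)
pose e := (Num.truncn (2 / eps)).+3.
have e_gt2 : (2 < e)%N by [].
have e_eps : 2 <= e%:R * eps.
  rewrite -ler_pdivrMr //; apply: le_trans (ltW (truncnS_gt _)) _.
  by rewrite ler_nat /e ltnS ltnW.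
(* The levels 0 to [G], [G.+1] in number, cover [[0, 1]] in steps of [delta]. *)
pose G := (Num.truncn delta^-1).+1.
have hG : 1 <= G%:R * delta by rewrite -ler_pdivrMr // div1r ltW ?truncnS_gt.
pose d := stable_height G.+1 k.
pose isig n := (Num.truncn (sigma n)^-1).+1.
have hisig n : 1 <= (isig n)%:R * sigma n.
  have /andP[s0 _] := hsigma n.
  by rewrite -ler_pdivrMr // div1r ltW ?truncnS_gt.
(* A chunk has density at least [1 / (2 * e * M1)] in [V] and [1 / (2 * e * M2)] in [W]; the sum
   serves both sides. *)
pose K M1 M2 := (2 * e * (M1 + M2))%N.
(* There will be at most [2 * e * M1] and [2 * e * M2] chunks, so [upto] bounds [1 / sigma] at their
   unknown product. *)
pose g M1 M2 := (2 * K M1 M2 * upto isig (2 * e * M1 * (2 * e * M2))).+1.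
(* [W] is partitioned after [V], with a bound depending on the number [M1] of pieces of [V]. The
   factor 2 in the scale is lost when passing to concentration. *)
have [N2 hN2] := boolp.choice (fun M1 =>
  partition_propertyP d e (fun M2 => 2 * g M1 M2)%N).
(* The scale for [V] must suit every number of pieces of [W] up to [N2 M1]. *)
have [N1 hN1] := partition_propertyP d e
  (fun M1 => upto (fun M2 => 2 * g M1 M2)%N (N2 M1)).
exists (2 * e * (N1 + upto N2 N1))%N => V W V0 W0 f f01 stf.
have [P [dP _ zP cP gP]] := hN1 _ _ _ _ _ (stable_no_tree G.+1 [set: V] stf).
have [Q [dQ _ zQ cQ gQ]] :=
  hN2 (size P) _ _ _ _ _ (stable_no_tree G.+1 [set: W] (stable_fun_swap stf)).
rewrite setTD cardsT in cP; rewrite setTD cardsT in cQ.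
have [c [P' [[dP' c0] eP' hP' [Vc /andP[P'0 zP']] cP']]] :=
  equal_refinement e_gt2 V0 dP cP.
have [c' [Q' [[dQ' c'0] eQ' hQ' [Wc /andP[Q'0 zQ']] cQ']]] :=
  equal_refinement e_gt2 W0 dQ cQ.
have N2_le : (N2 (size P) <= upto N2 N1)%N by exact: leq_upto.
have neq0 (T : finType) (s : seq {set T}) x : (0 < x)%N ->
    all (fun Y : {set T} => #|Y| == x) s -> all (fun Y : {set T} => Y != set0) s.
  by move=> x0 /allP h; apply/allP => Y /h /eqP Yx; rewrite -card_gt0 Yx.
have mem_part (T : finType) (s : seq {set T}) (E : {set T}) (i : 'I_(size s).+1) :
    i != ord0 -> nth set0 (E :: s) i \in s.
  by case: i => -[|i] //= lti _; rewrite mem_nth.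
exists (size P'), (size Q').
exists (fun i => nth set0 ((~: \bigcup_(Y <- P') Y) :: P') i).
exists (fun i => nth set0 ((~: \bigcup_(Y <- Q') Y) :: Q') i).
have small (T : finType) (E : {set T}) :
    (e * #|E| <= 2 * #|T|)%N -> #|E|%:R <= eps * #|T|%:R.
  move=> eE; rewrite -(ler_pM2l (_ : 0 < e%:R)) ?ltr0n // mulrA -natrM.
  apply: le_trans (_ : (2 * #|T|)%:R <= _); first by rewrite ler_nat.
  by rewrite natrM ler_wpM2r.
split.
- rewrite P'0 Q'0; split.
    by rewrite (leq_trans zP') // leq_mul2l (leq_trans zP) ?leq_addr ?orbT.
  rewrite (leq_trans zQ') // leq_mul2l (leq_trans zQ) ?orbT //.
  by rewrite (leq_trans N2_le) ?leq_addl.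
- by split; apply: exceptional_partition_seq => //; [apply: neq0 eP'|apply: neq0 eQ'].
- move=> i j /(mem_part _ P' (~: \bigcup_(Y <- P') Y)) iP'.
  move=> /(mem_part _ Q' (~: \bigcup_(Y <- Q') Y)) jQ'.
  move: iP' jQ'; set X1 := nth _ _ _; set Y1 := nth _ _ _ => X1P Y1Q.
  have /hasP[X XP sX] := allP hP' _ X1P; have /hasP[Y YQ sY] := allP hQ' _ Y1Q.
  have cX1 : #|X1| = c by apply/eqP/(allP eP').
  have cY1 : #|Y1| = c' by apply/eqP/(allP eQ').
  apply: (@homogeneous_subpair _ _ _ _ (3 / 2 * delta) _ _
    (g (size P) (size Q)) (K (size P) (size Q)) X _ Y _ f01) => //.
  + by lra.
  + apply: undivided_concentrated hG _ f01 _ => //.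
    apply: undividedS (allP gP _ XP).
    exact: (leq_upto (fun M2 => 2 * g (size P) M2)%N).
  + apply: undivided_concentrated hG _ (fun b a => f01 a b) _ => //.
    exact: (allP gQ _ YQ).
  + by rewrite -card_gt0 cX1.
  + by rewrite -card_gt0 cY1.
  + by rewrite cX1 (leq_trans Vc) // leq_mul2r leq_mul2l leq_addr !orbT.
  + by rewrite cY1 (leq_trans Wc) // leq_mul2r leq_mul2l leq_addl !orbT.
  set z := (size P' * size Q')%N.
  have hz : (isig z <= upto isig (2 * e * size P * (2 * e * size Q)))%N.
    exact/leq_upto/leq_mul.
  have /andP[s0 _] := hsigma z.
  (* The factor [isig z * sigma z >= 1] is inserted, and [2 * K * isig z] is at most the scale
     [g]. *)
  apply: le_trans (_ : (2 * K (size P) (size Q) * isig z)%:R * sigma z <= _).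
    by rewrite [X in _ <= X * _]natrM -mulrA ler_peMr.
  rewrite ler_pM2r // ler_nat; apply: leq_trans (leqnSn _).
  by rewrite leq_mul2l hz orbT.
- split=> i j /mem_part hi /mem_part hj.
    by rewrite (eqP (allP eP' _ (hi _))) (eqP (allP eP' _ (hj _))).
  by rewrite (eqP (allP eQ' _ (hi _))) (eqP (allP eQ' _ (hj _))).
- by split; apply: small.
Qed.
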